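(* Let $\eta>0$. Consider the Light Fault-Tolerant Greedy Spanner Algorithm modified so that $Q$ is a minimum-weight $(2+\eta)f$-EFT connectivity preserver of $G$ (instead of a $2f$-EFT one). Then for every $n$-node weighted graph $G$, $k\ge1$ and positive integer $f$, the output $f$-EFT spanner $H$ satisfies $$\ell_{(2+\eta)f}(H\mid G)\le O\big(\eta^{-1}\lambda(n,k+1)\big).$$
   Context: Graphs have nonnegative edge weights; $w(H)$ total weight; $\mathrm{mst}(H)$ a minimum spanning tree (forest). A subgraph $Q\subseteq G$ is an $f'$-EFT connectivity preserver if for every edge set $F$ with $|F|\le f'$ (i.e. $|F|\le\lfloor f'\rfloor$) the connected components of $Q\setminus F$ equal those of $G\setminus F$. The $f'$-competitive lightness is $\ell_{f'}(H\mid G):=w(H)/\min_Q w(Q)$ over all $f'$-EFT connectivity preservers $Q$ of $G$. Light Fault-Tolerant Greedy Spanner Algorithm on input $(G,k,f)$: let $Q$ be a minimum-weight $2f$-EFT connectivity preserver of $G$; $H\leftarrow Q$; for each edge $(u,v)\in E(G)\setminus Q$ in nondecreasing weight order, add $(u,v)$ to $H$ iff there exists $F\subseteq E(H)$, $|F|\le f$, with $\mathrm{dist}_{H\setminus F}(u,v)>k\cdot w(u,v)$ (current $H$); return $H$. Lightness $\ell(H)=w(H)/w(\mathrm{mst}(H))$; normalized weight of a cycle $C$ is $w(C)/\max_{e\in C}w(e)$; weighted girth is the minimum normalized weight over cycles; $\lambda(n,t):=\sup\ell(G)$ over $n$-node graphs $G$ of weighted girth $>t$.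
   Formalization: The factor η^{-1} is replaced by max(1, η^{-1}) with one absolute constant: for η ≤ 1 this is the stated bound, while for large η the literal bound fails (a tree G with k ≥ n has competitive lightness 1 and λ(n,k+1) = 1). *)

(* Defs.v *)
From HB Require Import structures.
From mathcomp Require Import all_boot all_order all_algebra.
From mathcomp Require Import boolp classical_sets reals ereal.

Set Implicit Arguments.
Unset Strict Implicit.
Unset Printing Implicit Defensive.

Import Order.TTheory GRing.Theory Num.Theory.

Local Open Scope ring_scope.
Local Open Scope ereal_scope.
Local Open Scope set_scope.

(* Finite simple graphs on V; an edge is the unordered pair of its ends.
   Subgraphs are spanning, so they are given by their edge sets. *)
Record wgraph (R : realType) (V : finType) := WGraph {
  edges : {set {set V}};
  weight : {set V} -> R;
  edges_card2 : forall e, e \in edges -> #|e| = 2%N;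
  weight_ge0 : forall e, e \in edges -> (0 <= weight e)%R }.

Section Graphs.
Variables (R : realType) (V : finType).
Implicit Types (G : wgraph R V) (E F H Q T : {set {set V}}).

Definition adj E : rel V := fun u v => [set u; v] \in E.

Definition components E : {set {set V}} :=
  equivalence_partition (connect (adj E)) [set: V].

Definition wt G H : R := (\sum_(e in H) weight G e)%R.

Definition walk_weight G (u : V) (p : seq V) : R :=
  (\sum_(e <- pairmap (fun x y => [set x; y]) u p) weight G e)%R.

(* +oo when no walk of E joins u to v. *)
Definition dist G E (u v : V) : \bar R :=
  ereal_inf [set x | exists2 p : seq V,
    path (adj E) u p /\ last u p = v & x = (walk_weight G u p)%:E]%classic.

Definition is_cycle E (c : seq V) : bool :=
  [&& (2 < size c)%N, uniq c & cycle (adj E) c].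

Definition cycle_edges (c : seq V) : {set {set V}} :=
  [set [set x; next c x] | x in c].

(* Quotients are taken in \bar R, where x / 0 = +oo for 0 < x and 0 / 0 = 0. *)
Definition normalized_weight G (c : seq V) : \bar R :=
  (wt G (cycle_edges c))%:E /
  (\big[Num.max/0%R]_(e in cycle_edges c) weight G e)%:E.

(* The infimum ranges over finitely many cycles; it is +oo on forests. *)
Definition weighted_girth G : \bar R :=
  ereal_inf [set x | exists2 c : seq V,
    is_cycle (edges G) c & x = normalized_weight G c]%classic.

Definition spanning_forest E T : Prop :=
  [/\ T \subset E, (forall c : seq V, ~~ is_cycle T c)
    & components T = components E].

Definition mst_weight G : \bar R :=
  ereal_inf [set x | exists2 T,
    spanning_forest (edges G) T & x = (wt G T)%:E]%classic.

Definition lightness G : \bar R := (wt G (edges G))%:E / mst_weight G.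

Definition eft_preserver G (f' : R) Q : Prop :=
  Q \subset edges G /\
  forall F, F \subset edges G -> (#|F|%:R <= f')%R ->
    components (Q :\: F) = components (edges G :\: F).

Definition min_eft_preserver G (f' : R) Q : Prop :=
  eft_preserver G f' Q /\
  forall Q', eft_preserver G f' Q' -> (wt G Q <= wt G Q')%R.

Definition competitive_lightness G (f' : R) H : \bar R :=
  (wt G H)%:E /
  ereal_inf [set x | exists2 Q, eft_preserver G f' Q & x = (wt G Q)%:E]%classic.

Definition must_add G (k : R) (f : nat) H (e : {set V}) : bool :=
  [exists F : {set {set V}}, [&& F \subset H, (#|F| <= f)%N &
    [exists u, exists v, (e == [set u; v]) &&
      ((k * weight G e)%:E < dist G (H :\: F) u v)]]].

Definition greedy_run G (k : R) (f : nat) Q (s : seq {set V}) : {set {set V}} :=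
  foldl (fun H e => if must_add G k f H e then e |: H else H) Q s.

(* H is a possible output of the greedy algorithm started from a minimum-weight
   f'-EFT connectivity preserver; the choice of that preserver and the order of
   edges of equal weight are arbitrary. *)
Definition light_ft_greedy_output G (k : R) (f : nat) (f' : R) H : Prop :=
  exists (Q : {set {set V}}) (s : seq {set V}),
    [/\ min_eft_preserver G f' Q,
        perm_eq s (enum (edges G :\: Q)),
        sorted (fun e1 e2 => (weight G e1 <= weight G e2)%R) s
      & H = greedy_run G k f Q s].

End Graphs.

Definition lambda (R : realType) (n : nat) (t : R) : \bar R :=
  ereal_sup [set x | exists (V : finType) (G : wgraph R V),
    [/\ #|V| = n, t%:E < weighted_girth G & x = lightness G]]%classic.

(* Main.v *)
(** Write [X] for the edges added to the preserver [Q], and [F e] for the set of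
    at most [f] edges that forced the addition of [e].  No cut of [Q] with at most
    [(2 + eta) f] edges separates the ends of an edge of [X], so for every cost [c]
    the primal-dual argument for Steiner forests yields [T] inside [Q] joining
    the ends of all edges of [X] with [(2 + eta) f * c T <= 2 * c Q].
    Since [F e] contains only [Q] and edges added before [e], [X] splits into
    [f + 1] classes such that [F e] misses the class of [e].  If [J] consists of
    the edges of a class with [F e] disjoint from [T], and [T'] is a minimum
    weight connector inside [T + J], then the heaviest weight on a cycle of
    [T' + J] is attained in [J], at the cycle's last added edge; so the weighted
    girth exceeds [k + 1] and [w J <= lambda * w T].  Hence
    [w X <= (f + 1) lambda * w T + \sum_(e in X) w e * #|F e :&: T|].  The right
    hand side is linear in [T], and taking it as the cost [c] gives
    [eta f * w X <= 2 (f + 1) lambda * w Q]. *)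

Require Import Defs.
From HB Require Import structures.
From mathcomp Require Import boolp classical_sets reals ereal.
From mathcomp Require Import all_boot all_order all_algebra.
From mathcomp Require Import zify ring lra.

Set Implicit Arguments.
Unset Strict Implicit.
Unset Printing Implicit Defensive.

Import Order.TTheory GRing.Theory Num.Theory.

Local Open Scope ring_scope.
Local Open Scope set_scope.

(** * Connectivity, components and cuts of edge sets *)

Section Connectivity.
Variable V : finType.
Implicit Types (E F Z T : {set {set V}}) (S X : {set V}) (e : {set V}).

Definition crosses S e : bool :=
  [exists x, exists y, [&& e == [set x; y], x \in S & y \notin S]].

Definition cut S E : {set {set V}} := [set e in E | crosses S e].

Definition component E x : {set V} := [set y | connect (adj E) x y].

Lemma crossesP S e :
  reflect (exists x y, [/\ e = [set x; y], x \in S & y \notin S]) (crosses S e).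
Proof.
apply: (iffP existsP) => [[x /existsP [y /and3P [/eqP -> xS yS]]]|[x [y [-> xS yS]]]].
  by exists x, y.
by exists x; apply/existsP; exists y; rewrite eqxx xS.
Qed.

Lemma adj_sym E : symmetric (adj E).
Proof. by move=> x y; rewrite /adj setUC. Qed.

Lemma connect_adj_sym E : connect_sym (adj E).
Proof. exact/sym_connect_sym/adj_sym. Qed.

Lemma connect_equiv E : equivalence_rel (connect (adj E)).
Proof.
move=> x y z; split=> [|xy]; first exact: connect0.
apply/idP/idP; apply: connect_trans => //.
by rewrite connect_adj_sym.
Qed.

Lemma connect_adjS E E' : E \subset E' ->
  subrel (connect (adj E)) (connect (adj E')).
Proof. by move=> /subsetP sE; apply: connect_sub => x y xy; apply/connect1/sE. Qed.

Lemma connect_edge E x y : [set x; y] \in E -> connect (adj E) x y.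
Proof. by move=> xyE; apply: connect1. Qed.

Lemma components_eqP E E' :
  components E = components E' <-> connect (adj E) =2 connect (adj E').
Proof.
split=> [EE' x y|EE'].
  have H D : (y \in pblock (components D) x) = connect (adj D) x y.
    by apply: pblock_equivalence_partition; rewrite ?inE // => a b c _ _ _;
       exact: connect_equiv.
  by rewrite -!H EE'.
rewrite /components /equivalence_partition; apply: eq_imset => x.
by apply/setP => y; rewrite !inE EE'.
Qed.

Lemma componentsE E : components E = [set component E x | x in [set: V]].
Proof.
rewrite /components /equivalence_partition; apply: eq_imset => x.
by apply/setP => y; rewrite !inE.
Qed.

Lemma componentsP E X : reflect (exists x, X = component E x) (X \in components E).
Proof.
rewrite componentsE; apply: (iffP imsetP) => [[x _ ->]|[x ->]]; first by exists x.
by exists x.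
Qed.

Lemma mem_component E x : x \in component E x.
Proof. by rewrite inE connect0. Qed.

Lemma component_eq E x y : y \in component E x -> component E x = component E y.
Proof.
rewrite inE => xy; apply/setP => z; rewrite !inE.
by have [_ ->] := connect_equiv E x y z.
Qed.

Lemma connect_crossing E S u v : connect (adj E) u v -> u \in S -> v \notin S ->
  exists x y, [/\ [set x; y] \in E, x \in S, y \notin S & connect (adj E) u x].
Proof.
case/connectP=> p; elim: p u => [|w p IH] u /=; first by move=> _ -> ->.
case/andP=> uw wp vE uS vS; case: (boolP (w \in S)) => wS; last first.
  by exists u, w; split=> //; apply: connect0.
have [x [y [xy xS yS wx]]] := IH w wp vE wS vS.
by exists x, y; split=> //; apply: connect_trans wx; apply: connect1.
Qed.

Lemma uncrossed_connect E S u v : (forall e, e \in E -> ~~ crosses S e) ->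
  connect (adj E) u v -> (u \in S) = (v \in S).
Proof.
move=> clS.
suff H a b : connect (adj E) a b -> a \in S -> b \in S.
  move=> uv; apply/idP/idP; apply: H => //.
  by rewrite connect_adj_sym.
move=> ab aS; apply: contraT => bS.
have [x [y [xyE xS yS _]]] := connect_crossing ab aS bS.
by have /negP[] := clS _ xyE; apply/crossesP; exists x, y.
Qed.

Lemma connect_add E x y u v : connect (adj ([set x; y] |: E)) u v ->
  [\/ connect (adj E) u v,
      connect (adj E) u x /\ connect (adj E) y v
    | connect (adj E) u y /\ connect (adj E) x v].
Proof.
case/connectP=> p; elim: p u => [|w p IH] u /=.
  by move=> _ ->; apply: Or31; apply: connect0.
case/andP=> uw wp vE; have {IH} H := IH w wp vE.
move: uw; rewrite /adj !inE => /orP[/eqP uw|uw]; last first.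
  have {}uw : connect (adj E) u w by apply: connect1.
  case: H => [wv|[wx yv]|[wy xv]].
  - by apply: Or31; apply: connect_trans wv.
  - by apply: Or32; split=> //; apply: connect_trans wx.
  - by apply: Or33; split=> //; apply: connect_trans wy.
have : u \in [set x; y] by rewrite -uw !inE eqxx.
have : w \in [set x; y] by rewrite -uw !inE eqxx orbT.
rewrite !inE => /orP[]/eqP wE /orP[]/eqP uE; subst u w.
- exact: H.
- case: H => [xv|[_ yv]|[_ xv]].
  + by apply: Or33; split=> //; apply: connect0.
  + exact: Or31.
  + by apply: Or33; split=> //; apply: connect0.
- case: H => [yv|[_ yv]|[_ xv]].
  + by apply: Or32; split=> //; apply: connect0.
  + by apply: Or32; split=> //; apply: connect0.
  + exact: Or31.
- exact: H.
Qed.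

Lemma connect_add_redundant E x y : connect (adj E) x y ->
  connect (adj ([set x; y] |: E)) =2 connect (adj E).
Proof.
move=> xy u v; apply/idP/idP; last by apply: connect_adjS; apply: subsetU1.
case/connect_add=> // [[ux yv]|[uy xv]].
  exact: connect_trans ux (connect_trans xy yv).
apply: connect_trans uy (connect_trans _ xv).
by rewrite connect_adj_sym.
Qed.

(** Sending each old component to the new one containing it is onto, and stays onto when the
    component of [y] is dropped, since that of [x] has the same image. *)
Lemma card_components_add E x y : ~~ connect (adj E) x y ->
  (#|components ([set x; y] |: E)| < #|components E|)%N.
Proof.
move=> nxy; set E' := _ |: E.
pose g X := [set v | [exists u in X, connect (adj E') u v]].
have gE w : g (component E w) = component E' w.
  apply/setP=> v; rewrite !inE; apply/exists_inP/idP => [[u]|wv].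
    rewrite inE => wu uv; apply: connect_trans uv.
    by apply: connect_adjS wu; apply: subsetU1.
  by exists w; rewrite ?mem_component.
have xy' : component E' x = component E' y.
  by apply: component_eq; rewrite inE; apply: connect_edge; rewrite setU11.
have yE : component E y \in components E by apply/componentsP; exists y.
rewrite (cardsD1 (component E y) (components E)) yE add1n ltnS.
apply: leq_trans (leq_imset_card g _).
apply/subset_leq_card/subsetP => X /componentsP [w ->].
apply/imsetP; case: (eqVneq (component E w) (component E y)) => [wy|wy].
  exists (component E x); last by rewrite gE xy' -!gE wy.
  rewrite !inE; apply/andP; split; last by apply/componentsP; exists x.
  apply/eqP=> xyE; move: nxy; have := mem_component E y.
  by rewrite -xyE inE => ->.
exists (component E w); last by rewrite gE.
by rewrite !inE wy; apply/componentsP; exists w.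
Qed.

(** Contracting the components of [Z] turns [T] into a forest; for [Z = set0] this is acyclicity of
    [T]. *)
Definition bridges Z T := forall x y, [set x; y] \in T ->
  ~~ connect (adj (Z :|: T :\ [set x; y])) x y.

Lemma card_bridges Z T : (forall e, e \in T -> #|e| = 2%N) -> bridges Z T ->
  (#|T| + #|components (Z :|: T)| <= #|components Z|)%N.
Proof.
have [m] := ubnP #|T|; elim: m T => // m IH T ltTm c2 br.
case: (set_0Vmem T) => [->|[e eT]]; first by rewrite setU0 cards0.
have [x [y [_ eE]]] : exists x y, x != y /\ e = [set x; y].
  by apply/cards2P; rewrite c2.
have {}nxy := br x y; rewrite -eE eT in nxy.
have := card_components_add (nxy isT); rewrite -eE setUCA setD1K // => lt.
have brT : bridges Z (T :\ e).
  move=> a b /setD1P[_ abT]; apply: contra (br a b abT).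
  by apply/connect_adjS/setUS/setSD/subsetDl.
have c2T e' : e' \in T :\ e -> #|e'| = 2%N by case/setD1P=> _; apply: c2.
have cT := cardsD1 e T; rewrite eT in cT.
have ltT : (#|T :\ e| < m)%N by lia.
apply: leq_trans (IH _ ltT c2T brT).
by rewrite cT add1n addSn -addnS leq_add2l.
Qed.

Lemma closed_component Z E X : Z \subset E -> X \in components Z ->
  (forall e, e \in E -> ~~ crosses X e) -> X \in components E.
Proof.
move=> sZE /componentsP [x ->] cl; apply/componentsP; exists x.
apply/setP => y; apply/idP/idP; rewrite !inE; first exact: connect_adjS.
by move=> /(uncrossed_connect cl); rewrite mem_component !inE.
Qed.

Lemma component_uncrossed Z X e : X \in components Z -> e \in Z -> ~~ crosses X e.
Proof.
move=> /componentsP [x ->] eZ; apply/crossesP=> [[u [v [eE]]]].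
rewrite !inE => xu /negP[]; apply: connect_trans xu _.
by apply: connect_edge; rewrite -eE.
Qed.

(** Only the components containing an end of [e] can be crossed by it. *)
Lemma card_crossed_components Z e :
  (#|[set X in components Z | crosses X e]| <= 2)%N.
Proof.
case: (set_0Vmem [set X in components Z | crosses X e]) => [->|[X0]].
  by rewrite cards0.
rewrite inE => /andP[_ /crossesP[x [y [eE _ _]]]].
apply: (@leq_trans #|[set component Z x; component Z y]|); last by rewrite cards2; case: eqP.
apply/subset_leq_card/subsetP => X; rewrite !inE => /andP[/componentsP[w ->]].
case/crossesP=> u [v [eE' uw _]].
rewrite (component_eq uw); have : u \in e by rewrite eE' !inE eqxx.
by rewrite eE !inE => /orP[]/eqP->; rewrite eqxx ?orbT.
Qed.

End Connectivity.

Lemma card_setE (T : finType) (A : {set T}) (p : pred T) :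
  #|[set x in A | p x]| = (\sum_(x in A) p x)%N.
Proof.
rewrite -sum1_card (eq_bigl (fun x => (x \in A) && p x)) => [|x]; last by rewrite inE.
by rewrite big_mkcondr; apply: eq_bigr => x _; case: (p x).
Qed.

(** * Steiner forests by the primal-dual (local-ratio) method *)

Section SteinerForest.
Variables (R : realFieldType) (V : finType) (D : rel V).
Implicit Types (Q T Z : {set {set V}}) (S X : {set V}).

Definition separates S : bool :=
  [exists u, exists v, D u v && ((u \in S) != (v \in S))].

Definition feasible T : bool := [forall u, forall v, D u v ==> connect (adj T) u v].

Lemma feasibleP T : reflect (forall u v, D u v -> connect (adj T) u v) (feasible T).
Proof.
apply: (iffP forallP) => [H u v Duv|H u].
  by have /forallP/(_ v)/implyP := H u; apply.
by apply/forallP=> v; apply/implyP; apply: H.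
Qed.

Lemma feasibleS T T' : T \subset T' -> feasible T -> feasible T'.
Proof.
by move=> sT /feasibleP f; apply/feasibleP => u v /f; apply: connect_adjS.
Qed.

Lemma separatesP S :
  reflect (exists u v, D u v /\ (u \in S) != (v \in S)) (separates S).
Proof.
apply: (iffP existsP) => [[u /existsP[v /andP[? ?]]]|[u [v [? ?]]]].
  by exists u, v.
by exists u; apply/existsP; exists v; apply/andP.
Qed.

Lemma inactive_feasible Z : (forall X, X \in components Z -> ~~ separates X) ->
  feasible Z.
Proof.
move=> na; apply/feasibleP => u v Duv; apply: contraT => nuv.
have /na/negP[] : component Z u \in components Z by apply/componentsP; exists u.
by apply/separatesP; exists u, v; split=> //; rewrite mem_component !inE (negbTE nuv).
Qed.

Definition active Z : {set {set V}} := [set X in components Z | separates X].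

(* Contract the components of Z: T becomes a forest all of whose leaves are
   active, so its average degree over the active nodes is less than 2. *)
Lemma active_degree Z T : (forall e, e \in T -> #|e| = 2%N) ->
  feasible (Z :|: T) -> (forall e, e \in T -> ~~ feasible (Z :|: T :\ e)) ->
  (\sum_(X in active Z) #|cut X T| <= 2 * #|active Z|)%N.
Proof.
move=> c2 fT minT; pose P := components Z.
(* Isolated nodes of the contracted forest; each is still a whole component of [Z :|: T]. *)
pose iso := [set X in P | #|cut X T| == 0%N].
have h1 : (\sum_(X in P) #|cut X T| <= \sum_(e in T) 2)%N.
  rewrite (eq_bigr (fun X => \sum_(e in T) crosses X e)%N); last first.
    by move=> X _; rewrite card_setE.
  rewrite exchange_big /=; apply: leq_sum => e _.
  by rewrite -card_setE; apply: card_crossed_components.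
(* An edge whose ends stay connected without it could be dropped, against minimality. *)
have br : bridges Z T.
  move=> x y xyT; apply: contra (minT _ xyT) => xy.
  apply/feasibleP=> u v /(feasibleP _ fT).
  by rewrite -[T in _ :|: T](setD1K xyT) setUCA connect_add_redundant.
have h2 : (#|T| + #|iso| <= #|P|)%N.
  apply: leq_trans (card_bridges c2 br); rewrite leq_add2l.
  apply/subset_leq_card/subsetP => X; rewrite inE cards_eq0 => /andP[XP /eqP X0].
  apply: (closed_component _ XP); first exact: subsetUl.
  move=> e; rewrite inE => /orP[eZ|eT]; first exact: component_uncrossed XP eZ.
  by apply/negP=> Xe; have := in_set0 e; rewrite -X0 inE eT Xe.
(* An inactive node of degree 1 is impossible: a demand relying on its only edge would have exactly
   one end in [X]. Degree 0 is compensated by the term for [iso]. *)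
have h3 X : X \in P -> ~~ separates X -> (2 <= #|cut X T| + 2 * (X \in iso))%N.
  move=> XP nX; rewrite inE XP /=.
  case: (posnP #|cut X T|) => [->//|]; rewrite addn0 leq_eqVlt => /orP[|//].
  rewrite eq_sym => /cards1P[e Xe].
  have : e \in cut X T by rewrite Xe set11.
  rewrite inE => /andP[eT /crossesP[x [y [eE xX yX]]]].
  case/negP: (minT e eT); apply/feasibleP => u v Duv.
  have clX g : g \in Z :|: T :\ e -> ~~ crosses X g.
    rewrite !inE => /orP[gZ|/andP[ge gT]]; first exact: component_uncrossed XP gZ.
    by apply: contra ge => Xg; rewrite -in_set1 -Xe inE gT.
  have := feasibleP _ fT u v Duv.
  rewrite -{1}(setD1K eT) setUCA {1}eE => /connect_add.
  have ns : ~ (u \in X) != (v \in X).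
    by move=> uv; case/negP: nX; apply/separatesP; exists u, v.
  case=> // -[/(uncrossed_connect clX) h /(uncrossed_connect clX) h']; case: ns.
    by rewrite h -h' xX (negbTE yX).
  by rewrite h -h' xX (negbTE yX).
have h4 : (\sum_(X in P) (#|cut X T| + 2 * (X \in iso)) <= \sum_(X in P) 2)%N.
  rewrite big_split /= -big_distrr /= sum_nat_const (mulnC #|_|).
  apply: (@leq_trans (2 * (#|T| + #|iso|))); last by rewrite leq_mul2l h2.
  rewrite mulnDr leq_add //; first by rewrite sum_nat_const mulnC in h1.
  rewrite leq_mul2l /= -card_setE; apply/subset_leq_card/subsetP => X.
  by rewrite !inE => /andP[_ ->].
(* Inactive nodes contribute at least 2 each to the left side, so cancelling them leaves the bound
   for the active ones. *)
rewrite (bigID separates) [X in (_ <= X)%N](bigID separates) /= in h4.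
have aE (g : {set V} -> nat) :
    (\sum_(X in active Z) g X = \sum_(X in P | separates X) g X)%N.
  by apply: eq_bigl => X; rewrite inE.
rewrite mulnC -sum_nat_const !aE.
rewrite -(leq_add2r (\sum_(X in P | ~~ separates X) 2)%N).
apply: leq_trans h4; apply: leq_add; apply: leq_sum => X; first by rewrite leq_addr.
by case/andP; apply: h3.
Qed.

Variables (Q : {set {set V}}) (N : R).
Hypothesis card2Q : forall e, e \in Q -> #|e| = 2%N.
Hypothesis N_gt0 : 0 < N.
Hypothesis cut_ge : forall S, separates S -> N <= #|cut S Q|%:R.

(** Charge each edge [eps] times the number of active components it crosses, with [eps] as large as
    nonnegative costs allow. For this charge a minimal solution pays at most twice the number of
    active components, while [Q] pays at least [N] times that number. The remaining cost has fewer
    nonzero values, so induction applies. *)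
Lemma steiner_forest (c : {set V} -> R) : (forall e, e \in Q -> 0 <= c e) ->
  exists T, [/\ T \subset Q, feasible T &
                N * (\sum_(e in T) c e) <= 2 * (\sum_(e in Q) c e)].
Proof.
have [m] := ubnP #|[set e in Q | c e != 0]|.
elim: m c => // m IH c ltm c0.
pose Z := [set e in Q | c e == 0].
have sZQ : Z \subset Q by apply/subsetP=> e; rewrite inE => /andP[].
have cZ : \sum_(e in Z) c e = 0 by apply: big1 => e; rewrite inE => /andP[_ /eqP].
case: (set_0Vmem (active Z)) => [A0|[X0 X0A]].
  exists Z; split=> //.
    apply: inactive_feasible => X XZ; apply/negP => sX.
    by have := in_set0 X; rewrite -A0 inE XZ sX.
  by rewrite cZ mulr0 mulr_ge0 ?sumr_ge0.
pose a e : R := (\sum_(X in active Z) crosses X e)%N%:R.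
have a_ge0 e : 0 <= a e by apply: ler0n.
have aS T : \sum_(e in T) a e = (\sum_(X in active Z) #|cut X T|)%N%:R.
  rewrite /a -natr_sum exchange_big; congr (_%:R); apply: eq_bigr => X _.
  by rewrite card_setE.
have aZ e : e \in Z -> a e = 0.
  move=> eZ; rewrite /a big1 // => X; rewrite inE => /andP[XZ _].
  by rewrite (negbTE (component_uncrossed XZ eZ)).
(* Since [N] is positive, some edge of [Q] leaves the active component [X0], so the ratio minimized
   next is defined somewhere. *)
have [q0 /andP[q0Q q0a]] : exists q, (q \in Q) && (0 < a q).
  have : N <= #|cut X0 Q|%:R by apply: cut_ge; move: X0A; rewrite inE => /andP[].
  case: (set_0Vmem (cut X0 Q)) => [->|[q]].
    by rewrite cards0 leNgt N_gt0.
  rewrite inE => /andP[qQ X0q] _; exists q; rewrite qQ.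
  by rewrite /a ltr0n (bigD1 X0) //= X0q.
case: (@arg_minP _ _ _ q0 (fun q => (q \in Q) && (0 < a q)) (fun q => c q / a q)).
  by rewrite q0Q.
move=> q /andP[qQ qa] qmin; set eps := c q / a q in qmin.
have eps0 : 0 <= eps by rewrite divr_ge0 ?c0.
pose c' e := c e - eps * a e.
have c'0 e : e \in Q -> 0 <= c' e.
  move=> eQ; rewrite /c' subr_ge0; case: (ltrgt0P (a e)) => [ea|ea|->].
  - by rewrite -ler_pdivlMr // qmin // eQ.
  - by have := a_ge0 e; rewrite leNgt ea.
  - by rewrite mulr0 c0.
have c'Z e : e \in Z -> c' e = 0.
  by move=> eZ; rewrite /c' aZ // mulr0 subr0; move: eZ; rewrite inE => /andP[_ /eqP].
have ltm' : (#|[set e in Q | c' e != 0%R]| < m)%N.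
  rewrite -ltnS; apply: leq_trans ltm; rewrite ltnS; apply: proper_card.
  apply/properP; split.
    apply/subsetP => e; rewrite !inE => /andP[eQ c'e]; rewrite eQ /=.
    by apply: contra c'e => ce; apply/eqP/c'Z; rewrite inE eQ.
  exists q; rewrite !inE qQ /=.
    apply/negP => cq; have : a q = 0 by apply: aZ; rewrite inE qQ.
    by move/eqP; rewrite gt_eqF.
  by rewrite negbK /c' /eps divfK ?subrr // gt_eqF.
have [T0 [sT0 fT0 cT0]] := IH c' ltm' c'0.
(* The inductive solution is pruned to a smallest subset that is feasible together with the free
   edges [Z], as the degree bound requires. *)
pose p T := (T \subset T0) && feasible (Z :|: T).
case: (@arg_minnP _ T0 p (fun T => #|T|)).
  by rewrite /p subxx (feasibleS _ fT0) // subsetUr.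
move=> T /andP[sTT0 fT] Tmin.
have minT e : e \in T -> ~~ feasible (Z :|: T :\ e).
  move=> eT; apply/negP=> fe.
  have /Tmin : p (T :\ e) by rewrite /p fe andbT (subset_trans _ sTT0) ?subsetDl.
  by rewrite (cardsD1 e T) eT ltnn.
have sTQ := subset_trans sTT0 sT0.
have TZ : [disjoint Z & T].
  rewrite disjoint_subset; apply/subsetP => e eZ; rewrite inE.
  apply/negP => eT; case/negP: (minT e eT); apply: feasibleS fT.
  rewrite -{1}(setD1K eT) setUCA subUset subxx andbT sub1set.
  by rewrite inE eZ.
exists (Z :|: T); split=> //; first by rewrite subUset sZQ.
have -> : \sum_(e in Z :|: T) c e = \sum_(e in T) c e.
  rewrite (eq_bigl [in [predU Z & T]]) => [|e]; last by rewrite !inE.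
  by rewrite bigU //= cZ add0r.
have cE A : \sum_(e in A) c e = \sum_(e in A) c' e + eps * \sum_(e in A) a e.
  rewrite mulr_sumr -big_split /=; apply: eq_bigr => e _.
  by rewrite /c' subrK.
have c'T : \sum_(e in T) c' e <= \sum_(e in T0) c' e.
  rewrite [X in _ <= X](big_setID T) /= (setIidPr sTT0) lerDl.
  by apply: sumr_ge0 => e /setDP[eT0 _]; apply: c'0; apply: (subsetP sT0).
have dT : \sum_(e in T) a e <= 2 * #|active Z|%:R.
  rewrite aS -natrM ler_nat; apply: active_degree => // e eT.
  by apply: card2Q; apply: (subsetP sTQ).
(* Every active component is a separating set, so the cut hypothesis applies to each. *)
have dQ : N * #|active Z|%:R <= \sum_(e in Q) a e.
  rewrite aS mulr_natr -sumr_const natr_sum; apply: ler_sum => X.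
  by rewrite inE => /andP[_]; apply: cut_ge.
rewrite !cE !mulrDr; apply: lerD.
  by apply: le_trans cT0; rewrite ler_pM2l.
rewrite !(mulrCA _ eps); apply: ler_wpM2l => //.
apply: (@le_trans _ _ (N * (2 * #|active Z|%:R))); first by rewrite ler_pM2l.
by rewrite mulrCA ler_pM2l ?ltr0n.
Qed.

End SteinerForest.

(** * Walks, and cycles opened at an edge *)

Section Walks.
Variables (R : realType) (V : finType) (G : wgraph R V).
Implicit Types (E C T J K : {set {set V}}) (u v x y : V) (p c : seq V).

Let walk_edges := pairmap (fun x y : V => [set x; y]).

Lemma path_adjE E u p : path (adj E) u p = all [in E] (walk_edges u p).
Proof. by elim: p u => //= w p IH u; rewrite IH. Qed.

Lemma walk_weight_rcons u p v :
  walk_weight G u (rcons p v) = walk_weight G u p + weight G [set last u p; v].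
Proof.
rewrite /walk_weight; elim: p u => [|w p IH] u /=.
  by rewrite big_cons !big_nil addr0 add0r.
by rewrite !big_cons IH addrA.
Qed.

Lemma walk_rev E u p : path (adj E) u p -> exists q,
  [/\ path (adj E) (last u p) q, last (last u p) q = u
    & walk_weight G (last u p) q = walk_weight G u p].
Proof.
elim: p u => [|w p IH] u /=; first by exists [::].
case/andP=> uw /IH [q [pq lq wq]]; exists (rcons q u); split.
- by rewrite rcons_path pq lq adj_sym.
- by rewrite last_rcons.
- by rewrite walk_weight_rcons wq lq /walk_weight /= big_cons addrC setUC.
Qed.

Lemma walk_edges_sub u p e x : e \in walk_edges u p -> x \in e -> x \in u :: p.
Proof.
elim: p u => //= w p IH u; rewrite inE => /orP[/eqP->|/IH h /h].
  by rewrite !inE => /orP[]->; rewrite ?orbT.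
by rewrite !inE => ->; rewrite orbT.
Qed.

Lemma uniq_walk_edges u p : uniq (u :: p) -> uniq (walk_edges u p).
Proof.
elim: p u => //= w p IH u /andP[uNwp wp]; rewrite IH // andbT.
by apply: contra uNwp => /walk_edges_sub; apply; rewrite !inE eqxx.
Qed.

Lemma cycle_edges_rot n c : uniq c -> cycle_edges (rot n c) = cycle_edges c.
Proof.
move=> Uc; apply/setP => e; apply/imsetP/imsetP => [[x xc ->]|[x xc ->]];
  by exists x; rewrite ?next_rot ?mem_rot // -(mem_rot n).
Qed.

Lemma cycle_edgesE x q : uniq (x :: q) ->
  cycle_edges (x :: q) =i walk_edges x (rcons q x).
Proof.
move=> Uc e; suff -> : walk_edges x (rcons q x) =
    [seq [set z; next (x :: q) z] | z <- x :: q].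
  by apply/imsetP/mapP.
apply: (@eq_from_nth _ set0) => [|i]; rewrite size_pairmap size_rcons ?size_map //.
move=> ltiq; rewrite (nth_pairmap x) ?size_rcons // (nth_map x) //.
have nq : nth x (rcons q x) i = nth x q i.
  rewrite nth_rcons; case: ltngtP => // h; last by rewrite nth_default ?h.
  by rewrite nth_default // ltnW.
rewrite next_nth mem_nth // index_uniq // nq; congr [set _; _].
case: i ltiq {nq} => //= i; rewrite ltnS => ltiq.
by rewrite nth_rcons ltiq.
Qed.

(** Deleting an edge of a cycle leaves a path between its ends. Having at least three vertices
    ensures that the deleted edge does not recur on this path. *)
Lemma cycle_walk E c u v : is_cycle E c -> [set u; v] \in cycle_edges c ->
  exists p, [/\ path (adj (cycle_edges c :\ [set u; v])) u p, last u p = v &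
    walk_weight G u p = wt G (cycle_edges c) - weight G [set u; v]].
Proof.
case/and3P=> sc Uc _ uvC; move: (uvC) => /imsetP[x xc uvE].
suff [p [pp lp wp]] : exists p,
    [/\ path (adj (cycle_edges c :\ [set u; v])) (next c x) p, last (next c x) p = x &
    walk_weight G (next c x) p = wt G (cycle_edges c) - weight G [set u; v]].
  have [r [pr lr wr]] := walk_rev pp; rewrite lp in pr lr wr.
  have : v \in [set x; next c x] by rewrite -uvE !inE eqxx orbT.
  have : u \in [set x; next c x] by rewrite -uvE !inE eqxx.
  have : x \in [set u; v] by rewrite uvE !inE eqxx.
  have : next c x \in [set u; v] by rewrite uvE !inE eqxx orbT.
  rewrite !inE => h1 h2 h3 h4.
  (* The pair may be named in either orientation; one of them needs the reversed walk. *)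
  have [[ux vy]|[uy vx]] : (u = x /\ v = next c x) \/ (u = next c x /\ v = x).
    by move: h1 h2 h3 h4 => /orP[]/eqP + /orP[]/eqP + /orP[]/eqP + /orP[]/eqP;
       do ?move=> ->; intuition congruence.
  - exists r; rewrite -vy in wp lr wr; rewrite -ux in pr lr wr.
    by rewrite wr wp.
  - exists p; rewrite -uy in pp lp wp; rewrite -vx in lp.
    by [].
have [i q cE] := rot_to xc.
rewrite -(cycle_edges_rot i Uc) -(next_rot i Uc) in uvE uvC *.
rewrite -(size_rot i) in sc; rewrite -(rot_uniq i) in Uc.
move: sc Uc uvE uvC; rewrite {}cE; case: q => [|y [|z q]] // _.
set c' := [:: x, y, z & q] => Uc uvE uvC.
have nx : next c' x = y by rewrite /= eqxx.
rewrite nx in uvE *; rewrite uvE in uvC *.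
have CE := cycle_edgesE Uc.
have [[xy xz xq] [yz yq]] :
    [/\ x != y, x != z & x \notin q] /\ (y != z /\ y \notin q).
  by move: Uc; rewrite /c' /= !inE !negb_or => /and4P[/and3P[? ? ?] /andP[? ?] _ _].
have nL : [set x; y] \notin walk_edges y (rcons (z :: q) x).
  rewrite rcons_cons {1}/walk_edges [pairmap _ _ _]/= in_cons negb_or.
  apply/andP; split.
    by apply/eqP/setP => /(_ x); rewrite !inE eqxx (negbTE xy) (negbTE xz).
  apply/negP => /(@walk_edges_sub z) /(_ (set22 x y)).
  by rewrite inE mem_rcons inE (negbTE yz) eq_sym (negbTE xy) (negbTE yq).
(* [wt] sums over a set, so the listed edges must be distinct for it to equal the sum along the
   list. *)
have UL : uniq (walk_edges y (rcons (z :: q) x)).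
  by apply: uniq_walk_edges; rewrite -rcons_cons rcons_uniq.
pose L := walk_edges y (rcons (z :: q) x).
have LE : walk_edges x (rcons (y :: z :: q) x) = [set x; y] :: L by [].
rewrite LE in CE.
exists (rcons (z :: q) x); split; last 1 first.
- have -> : wt G (cycle_edges c') = \sum_(e <- [set x; y] :: L) weight G e.
    rewrite /wt big_uniq; last by rewrite cons_uniq nL UL.
    by apply: eq_bigl => e; rewrite CE.
  by rewrite big_cons addrC addKr.
- rewrite path_adjE; apply/allP => e eL; rewrite /= !inE CE inE eL orbT andbT.
  by apply: contra nL => /eqP <-.
- by rewrite last_rcons.
Qed.

Lemma cycle_edges_sub E c : is_cycle E c -> cycle_edges c \subset E.
Proof.
case/and3P=> _ Uc Cc; apply/subsetP => e /imsetP[x xc ->].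
by have := next_cycle Cc xc.
Qed.

Lemma cycle_edges_neq0 E c : is_cycle E c -> exists e, e \in cycle_edges c.
Proof.
case: c => [|x c] //= _; exists [set x; next (x :: c) x].
by apply/imsetP; exists x; rewrite // mem_head.
Qed.

Lemma cycle_connect E c u v : is_cycle E c -> [set u; v] \in cycle_edges c ->
  connect (adj (cycle_edges c :\ [set u; v])) u v.
Proof.
by move=> cc uv; have [p [pp lp _]] := cycle_walk cc uv; apply/connectP; exists p.
Qed.

End Walks.

(** * Minimum-weight connectors and edge exchange *)

Section MinConnector.
Variables (R : realType) (V : finType) (G : wgraph R V).
Implicit Types (E A B C T J K : {set {set V}}).

Lemma wt_ge0 A : A \subset edges G -> 0 <= wt G A.
Proof. by move=> /subsetP sA; apply: sumr_ge0 => e /sA; apply: weight_ge0. Qed.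

Lemma wtD1 A e : e \in A -> wt G A = weight G e + wt G (A :\ e).
Proof. by move=> eA; rewrite /wt (big_setD1 e). Qed.

Lemma wt_sub A B : A \subset B -> B \subset edges G -> wt G A <= wt G B.
Proof.
move=> sAB sB; rewrite /wt [X in _ <= X](big_setID A) /= (setIidPr sAB) lerDl.
by apply: wt_ge0; apply: subset_trans sB; apply: subsetDl.
Qed.

Lemma bridges_acyclic T c : bridges set0 T -> ~~ is_cycle T c.
Proof.
move=> br; apply/negP => cT; have [e eC] := cycle_edges_neq0 cT.
have sC := cycle_edges_sub cT; have /imsetP[x _ eE] := eC; rewrite eE in eC.
have /negP[] := br _ _ (subsetP sC _ eC); rewrite set0U.
exact: connect_adjS (setSD _ sC) _ _ (cycle_connect G cT eC).
Qed.

(* If no edge of J were heaviest on a cycle, a heaviest edge, lying in T',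
   could be swapped for a lighter edge of J. *)
Lemma min_connector T J : T \subset edges G -> J \subset edges G ->
  (forall x y, [set x; y] \in J -> connect (adj T) x y) ->
  exists T', [/\ T' \subset T :|: J, wt G T' <= wt G T, bridges set0 T',
    connect (adj T') =2 connect (adj (T' :|: J))
    & forall c, is_cycle (T' :|: J) c ->
      exists2 j, j \in cycle_edges c :&: J
               & forall g, g \in cycle_edges c -> weight G g <= weight G j].
Proof.
move=> sTG sJG Jconn; pose U := T :|: J.
have sUG : U \subset edges G by rewrite subUset sTG.
pose conn A := (A \subset U) &&
  [forall x, forall y, connect (adj A) x y == connect (adj U) x y].
have connP A : reflect (A \subset U /\ connect (adj A) =2 connect (adj U)) (conn A).
  apply: (iffP andP) => -[sA cA]; split=> //.
    by move=> x y; apply/eqP; have /forallP/(_ x)/forallP/(_ y) := cA.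
  by apply/forallP => x; apply/forallP => y; rewrite cA.
have connT : conn T.
  apply/connP; split=> [|x y]; first exact: subsetUl.
  apply/idP/idP; first by apply: connect_adjS; apply: subsetUl.
  apply: connect_sub => {}x {}y; rewrite /adj inE => /orP[|/Jconn//].
  exact: connect_edge.
(* Weight is minimized first and the number of edges second: edges of weight zero could otherwise
   leave cycles in a lightest connector. *)
case: (@arg_minP _ _ _ T conn (wt G) connT) => A connA minA.
case: (@arg_minnP _ A (fun B => conn B && (wt G B <= wt G A)) (fun B => #|B|)).
  by rewrite connA lexx.
move=> T' /andP[connT' wT'] card_min.
have wmin B : conn B -> wt G T' <= wt G B.
  by move=> /minA; apply: le_trans.
have [sT'U cT'] := connP _ connT'.
have br : bridges set0 T'.
  move=> x y xyT; rewrite set0U; apply/negP => xy.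
  have connD : conn (T' :\ [set x; y]).
    apply/connP; split; first exact: subset_trans (subsetDl _ _) sT'U.
    by move=> u v; rewrite -cT' -{2}(setD1K xyT) connect_add_redundant.
  have : wt G (T' :\ [set x; y]) <= wt G A.
    apply: le_trans wT'; apply: wt_sub; first exact: subsetDl.
    exact: subset_trans sUG.
  move=> wD; have := card_min (T' :\ [set x; y]); rewrite connD wD => /(_ isT).
  by rewrite (cardsD1 [set x; y] T') xyT ltnn.
have sT'J : T' :|: J \subset U by rewrite subUset sT'U subsetUr.
exists T'; split=> //; first exact: wmin.
  move=> x y; apply/idP/idP; first by apply: connect_adjS; apply: subsetUl.
  by rewrite cT'; apply: connect_adjS.
move=> c cc; pose C := cycle_edges c.
have sC : C \subset T' :|: J := cycle_edges_sub cc.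
have [e0 e0C] := cycle_edges_neq0 cc.
case: (@arg_maxP _ _ _ e0 [in C] (weight G) e0C) => g gC gmax.
case: (boolP [exists j in C :&: J, weight G g <= weight G j]).
  case/exists_inP=> j jCJ gj; exists j => // h hC.
  exact: le_trans (gmax h hC) gj.
rewrite negb_exists_in => /forall_inP lt; exfalso.
have gNJ : g \notin J.
  by apply/negP=> gJ; have := lt g; rewrite inE gC gJ lexx => /(_ isT).
have gT : g \in T'.
  by have := subsetP sC g gC; rewrite inE (negbTE gNJ) orbF.
have /imsetP[x _ gE] := gC; set y := next c x in gE; rewrite gE in gC gT.
have nxy := br _ _ gT; rewrite set0U in nxy.
(* The rest of the cycle crosses the cut that [g] bridges in [T']. The crossing edge [ab] lies
   outside [T'], hence in [J], and is lighter than [g]. *)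
have [] := @connect_crossing _ _ (component (T' :\ [set x; y]) x) _ _
  (cycle_connect G cc gC).
- exact: mem_component.
- by rewrite inE.
move=> a [b [abC]]; rewrite !inE => xa nxb _.
have /setD1P[abg {}abC] := abC.
have abT : [set a; b] \notin T'.
  apply/negP => abT; case/negP: nxb; apply: connect_trans xa _.
  by apply: connect_edge; rewrite !inE abg.
have abJ : [set a; b] \in J by have := subsetP sC _ abC; rewrite inE (negbTE abT).
have := lt [set a; b]; rewrite inE abC abJ -ltNge => /(_ isT) ltab.
pose B := [set a; b] |: T' :\ [set x; y].
have xyB : connect (adj B) x y.
  have sub : subrel (connect (adj (T' :\ [set x; y]))) (connect (adj B)).
    by apply: connect_adjS; apply: subsetU1.
  apply: connect_trans (sub _ _ xa) _.
  apply: (@connect_trans _ _ b); first by apply: connect_edge; rewrite setU11.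
  (* The ends of [ab] are joined in [T'] only through [g], so [b] lies on the side of [y] and [B]
     reconnects [x] to [y]. *)
  have : connect (adj T') a b.
    by rewrite cT'; apply: connect_edge; rewrite inE abJ orbT.
  rewrite -(setD1K gT) => /connect_add[ab|[_ yb]|[_ xb]].
  - by case/negP: nxb; apply: connect_trans ab.
  - by rewrite connect_adj_sym; apply: sub.
  - by rewrite xb in nxb.
have connB : conn B.
  apply/connP; split.
    rewrite subUset sub1set [_ \in U]inE abJ orbT /=.
    exact: subset_trans (subsetDl _ _) sT'U.
  move=> u v; apply/idP/idP.
    apply: connect_adjS; rewrite subUset sub1set [_ \in U]inE abJ orbT /=.
    exact: subset_trans (subsetDl _ _) sT'U.
  rewrite -cT' -(connect_add_redundant xyB); apply: connect_adjS.
  by rewrite -{1}(setD1K gT) setUS // subsetU1.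
have := wmin B connB; rewrite (wtD1 gT) (wtD1 (setU11 _ _)) setU1K; last first.
  by rewrite !inE (negbTE abT) andbF.
by rewrite lerD2r -gE leNgt ltab.
Qed.

End MinConnector.

(** * Weighted girth and lightness of subgraphs *)

(** The normalized weight depends only on the edge set of the cycle, so the infimum is a minimum
    over finitely many values and strictness survives. Without cycles it is [+oo]. *)
Lemma weighted_girth_gt (R : realType) (V : finType) (G : wgraph R V) (t : R) :
  ((forall c, is_cycle (edges G) c -> t%:E < normalized_weight G c) ->
  t%:E < weighted_girth G)%E.
Proof.
move=> tc; pose nw (E : {set {set V}}) : \bar R :=
  ((wt G E)%:E / (\big[Num.max/0%R]_(e in E) weight G e)%:E)%E.
pose p (E : {set {set V}}) := `[< exists2 c, is_cycle (edges G) c & E = cycle_edges c >].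
case: (pselect (exists E, p E)) => [[E0 pE0]|np]; last first.
  rewrite /weighted_girth (_ : [set x | _]%classic = classical_sets.set0) ?ereal_inf0 ?ltry //.
  apply/seteqP; split=> // x [c cc _]; apply: np; exists (cycle_edges c).
  by apply/asboolP; exists c.
case: (@arg_minP _ _ _ E0 p nw pE0) => E /asboolP [c cc EE] Emin.
apply: (lt_le_trans (tc c cc)); apply: le_ereal_inf_tmp => x [d dc ->].
have := Emin (cycle_edges d); rewrite EE; apply.
by apply/asboolP; exists d.
Qed.

Section Lambda.
Variables (R : realType) (V : finType) (G : wgraph R V).
Implicit Types (E A B C T J K : {set {set V}}).
Local Open Scope ereal_scope.

Definition subgraph K (sK : K \subset edges G) : wgraph R V :=
  @WGraph R V K (weight G) (fun e eK => @edges_card2 R V G e (subsetP sK e eK))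
    (fun e eK => @weight_ge0 R V G e (subsetP sK e eK)).

(** Witnessed by the edgeless graph, whose weighted girth is [+oo] and whose lightness is 0. *)
Lemma lambda_ge0 (t : R) : 0 <= lambda #|V| t.
Proof.
have s0 : set0 \subset edges G by apply: sub0set.
apply: ereal_sup_ubound; exists V, (subgraph s0); split=> //.
  apply: weighted_girth_gt => c; case/and3P=> + _.
  by case: c => //= x c _; case: c => //= [|y c]; rewrite /adj !inE.
by rewrite /lightness /wt /= big_set0 mul0e.
Qed.

Lemma lambda_lightness (t L : R) K T (sK : K \subset edges G) :
  lambda #|V| t = L%:E -> t%:E < weighted_girth (subgraph sK) ->
  spanning_forest K T -> (wt G K <= L * wt G T)%R.
Proof.
move=> lamE girth sfT; have L0 := lambda_ge0 t; rewrite lamE lee_fin in L0.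
set m := mst_weight (subgraph sK).
have m0 : 0 <= m.
  apply: le_ereal_inf_tmp => x [T1 [sT1 _ _] ->]; rewrite lee_fin.
  exact: wt_ge0 (subset_trans sT1 sK).
have mT : m <= (wt G T)%:E by apply: ereal_inf_lbound; exists T.
have : lightness (subgraph sK) <= L%:E.
  by rewrite -lamE; apply: ereal_sup_ubound; exists V, (subgraph sK).
rewrite /lightness -/m; change (wt (subgraph sK) _) with (wt G K).
case: m m0 mT => [m| |] //; rewrite !lee_fin => m0 mT.
(* Dividing a positive weight by a zero forest weight would give infinite lightness, against the
   finite bound [L]. *)
rewrite inver; case: (eqVneq m 0%R) => [mE|mN].
  case: (ltrgt0P (wt G K)) => [K0|K0|-> _]; last first.
  - by apply: mulr_ge0 => //; apply: le_trans mT.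
  - by have := wt_ge0 sK; rewrite leNgt K0.
  - by rewrite gt0_muley ?lte_fin // leye_eq.
have mp : (0 < m)%R by rewrite lt_def mN.
rewrite -EFinM lee_fin ler_pdivrMr // => /le_trans; apply.
by rewrite ler_wpM2l.
Qed.

Lemma acyclic_lightness (t L : R) T : lambda #|V| t = L%:E -> T \subset edges G ->
  bridges set0 T -> (wt G T <= L * wt G T)%R.
Proof.
move=> lamE sT br; apply: (lambda_lightness (sK := sT) lamE).
  apply: weighted_girth_gt => c cT.
  by have := bridges_acyclic G c br; rewrite cT.
by split=> // c; apply: (bridges_acyclic G).
Qed.

End Lambda.

(* Greedy colouring: [F e] are the at most f neighbours of e that precede it. *)
Lemma degenerate_coloring (T : finType) (f : nat) (s : seq T) (F : T -> {set T}) :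
  uniq s -> (forall e, e \in s -> (#|F e| <= f)%N) ->
  (forall e x, e \in s -> x \in s -> x \in F e -> (index x s < index e s)%N) ->
  exists col : T -> 'I_f.+1,
    forall e x, e \in s -> x \in s -> x \in F e -> col x != col e.
Proof.
elim/last_ind: s => [|s e IH] Us Ff ord; first by exists (fun=> ord0).
move: Us; rewrite rcons_uniq => /andP[es Us].
have ins x : x \in s -> x \in rcons s e by rewrite mem_rcons inE => ->; rewrite orbT.
have idx x : x \in s -> index x (rcons s e) = index x s.
  by move=> xs; rewrite -cats1 index_cat xs.
have idxe : index e (rcons s e) = size s by rewrite -cats1 index_cat (negbTE es) /= eqxx addn0.
have [||col colP] := IH Us.
- by move=> x /ins; apply: Ff.
- by move=> x y xs ys yF; have := ord x y (ins x xs) (ins y ys) yF; rewrite !idx.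
have [i iN] : exists i : 'I_f.+1, i \notin [set col x | x in F e].
  have : (#|[set col x | x in F e]| < #|'I_f.+1|)%N.
    rewrite card_ord ltnS; apply: leq_trans (leq_imset_card _ _) _.
    by apply: Ff; rewrite mem_rcons mem_head.
  rewrite -cardsT ltnNge; move/negP => h.
  have /subsetPn[i _ iN] : ~~ ([set: 'I_f.+1] \subset [set col x | x in F e]).
    by apply/negP => /subset_leq_card.
  by exists i.
exists (fun x => if x == e then i else col x) => y x yS xS xF.
have lt := ord y x yS xS xF.
move: yS xS; rewrite !mem_rcons !inE.
case: (eqVneq y e) => [yE _|ye /= ys]; case: (eqVneq x e) => [xE _|xe /= xs].
- by move: lt; rewrite xE yE ltnn.
- apply: contraNneq iN => <-; apply/imsetP; exists x => //.
  by rewrite -yE.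
- by move: lt; rewrite xE idxe idx // ltnNge ltnW // index_mem.
- exact: colP.
Qed.

(** * Runs of the greedy algorithm *)

Section Greedy.
Variables (R : realType) (V : finType) (G : wgraph R V) (k : R) (f : nat).
Implicit Types (Q H : {set {set V}}) (s : seq {set V}).

Lemma greedy_run_sub Q s e : e \in greedy_run G k f Q s -> (e \in Q) || (e \in s).
Proof.
elim: s Q => [|a s IH] Q /=; first by move->.
move/IH; rewrite inE; case: ifP => _; last by case/orP=> ->; rewrite ?orbT.
by rewrite !inE => /orP[/orP[]|] ->; rewrite ?orbT.
Qed.

Lemma greedy_run_sup Q s : Q \subset greedy_run G k f Q s.
Proof.
elim: s Q => [|a s IH] Q //=; apply: subset_trans (IH _).
by case: ifP => _ //; apply: subsetU1.
Qed.

(** Decisions are never revised, so an intermediate state is the final output restricted to [Q] and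
    the edges already examined. *)
Lemma greedy_run_take Q s i e : uniq s -> (forall x, x \in s -> x \notin Q) ->
  e \in greedy_run G k f Q (take i s) =
  (e \in Q) || (e \in greedy_run G k f Q s) && (index e s < i)%N.
Proof.
move=> Us sQ; have HE : greedy_run G k f Q s =
    greedy_run G k f (greedy_run G k f Q (take i s)) (drop i s).
  by rewrite /greedy_run -foldl_cat cat_take_drop.
apply/idP/idP => [eH|].
  case: (boolP (e \in Q)) => //= eQ.
  have := greedy_run_sub eH; rewrite (negbTE eQ) /= => es.
  rewrite HE (subsetP (greedy_run_sup _ _) _ eH) /=.
  rewrite -(cat_take_drop i s) index_cat es.
  apply: (@leq_trans (size (take i s))); first by rewrite index_mem.
  by rewrite size_take_min geq_minl.
case/orP=> [eQ|/andP[]]; first exact: (subsetP (greedy_run_sup _ _)).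
rewrite HE => /greedy_run_sub/orP[//|ed] lt; exfalso.
move: (Us); rewrite -(cat_take_drop i s) cat_uniq => /and3P[_ /hasPn/(_ e ed) net _].
move: lt; rewrite -{1}(cat_take_drop i s) index_cat (negbTE net) size_take_min.
have := ed; rewrite -index_mem size_drop => h.
by move: h; lia.
Qed.

Lemma greedy_must_add Q s e : uniq s -> (forall x, x \in s -> x \notin Q) ->
  e \in greedy_run G k f Q s -> e \notin Q ->
  must_add G k f (greedy_run G k f Q (take (index e s) s)) e.
Proof.
move=> Us sQ eH eQ; have := greedy_run_sub eH; rewrite (negbTE eQ) /= => es.
set i := index e s; have ltis : (i < size s)%N by rewrite index_mem.
have := greedy_run_take i.+1 e Us sQ; rewrite eH (negbTE eQ) ltnSn /=.
rewrite (take_nth e ltis) nth_index // /greedy_run foldl_rcons -/(greedy_run _ _ _ _ _).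
case: ifP => // _; rewrite greedy_run_take // (negbTE eQ) ltnn andbF //.
Qed.

End Greedy.

(** Were the cut small, it could fail as a whole: the edge [uv], lying outside [Q], would survive in
    [G], while nothing left in [Q] crosses [S]. *)
Lemma eft_preserver_cut (R : realType) (V : finType) (G : wgraph R V) (N : R)
    (Q : {set {set V}}) (u v : V) (S : {set V}) :
  eft_preserver G N Q -> [set u; v] \in edges G -> [set u; v] \notin Q ->
  (u \in S) != (v \in S) -> N < #|cut S Q|%:R.
Proof.
move=> [sQ pQ] uvG uvQ uvS; rewrite ltNge; apply/negP => le.
have sF : cut S Q \subset edges G.
  by apply: subset_trans sQ; apply/subsetP => e; rewrite inE => /andP[].
have /components_eqP cE := pQ _ sF le.
have : connect (adj (edges G :\: cut S Q)) u v.
  by apply: connect_edge; rewrite !inE (negbTE uvQ).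
rewrite -cE => /(@uncrossed_connect _ _ S) h; move/negP: uvS; apply; apply/eqP/h => e.
by rewrite !inE; case: (e \in Q); rewrite //= andbT.
Qed.

(** * Weight of the added edges, by means of their fault sets *)

Section Blocking.
Variables (R : realType) (V : finType) (G : wgraph R V) (k : R) (f : nat).
Variables (Q : {set {set V}}) (s : seq {set V}).
Implicit Types (A C T J : {set {set V}}).
Hypothesis sQG : Q \subset edges G.
Hypothesis sE : perm_eq s (enum (edges G :\: Q)).
Hypothesis s_sorted : sorted (fun e1 e2 => weight G e1 <= weight G e2) s.

Let H := greedy_run G k f Q s.
Let X := H :\: Q.
Let before e := greedy_run G k f Q (take (index e s) s).

Lemma uniq_edges_left : uniq s.
Proof. by rewrite (perm_uniq sE) enum_uniq. Qed.

Lemma mem_edges_left e : (e \in s) = (e \in edges G) && (e \notin Q).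
Proof. by rewrite (perm_mem sE) mem_enum inE andbC. Qed.

Lemma notin_edges_left e : e \in s -> e \notin Q.
Proof. by rewrite mem_edges_left => /andP[]. Qed.

Lemma beforeE e x : (x \in before e) =
  (x \in Q) || (x \in X) && (index x s < index e s)%N.
Proof.
rewrite /before greedy_run_take; last exact: notin_edges_left.
  by rewrite !inE; case: (x \in Q).
exact: uniq_edges_left.
Qed.

Lemma added_mem e : e \in X -> e \in s.
Proof. by rewrite inE => /andP[eQ /greedy_run_sub]; rewrite (negbTE eQ). Qed.

Lemma added_sub : X \subset edges G.
Proof. by apply/subsetP=> e /added_mem; rewrite mem_edges_left => /andP[]. Qed.

Lemma blocking_sets : exists F : {set V} -> {set {set V}},
  forall e, e \in X -> [/\ F e \subset before e, (#|F e| <= f)%N &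
    exists u v, e = [set u; v] /\
      ((k * weight G e)%:E < dist G (before e :\: F e) u v)%E].
Proof.
have h e : exists F : {set {set V}},
    e \in X -> [/\ F \subset before e, (#|F| <= f)%N &
      exists u v, e = [set u; v] /\
        ((k * weight G e)%:E < dist G (before e :\: F) u v)%E].
  case: (boolP (e \in X)) => [|_]; last by exists set0.
  rewrite inE => /andP[eQ eH].
  have /existsP[F /and3P[sF cF /existsP[u /existsP[v /andP[/eqP eE d]]]]] :=
    greedy_must_add uniq_edges_left notin_edges_left eH eQ.
  by exists F => _; split=> //; exists u, v.
by have [F FP] := choice h; exists F.
Qed.

Variable F : {set V} -> {set {set V}}.
Hypothesis FP : forall e, e \in X ->
  [/\ F e \subset before e, (#|F e| <= f)%N &
    exists u v, e = [set u; v] /\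
      ((k * weight G e)%:E < dist G (before e :\: F e) u v)%E].
Variable L : R.
Hypothesis lamE : lambda #|V| (k + 1) = L%:E.
Hypothesis k1 : 1 <= k.

Lemma L_ge0 : 0 <= L.
Proof. by have := lambda_ge0 G (k + 1); rewrite lamE lee_fin. Qed.

(** The rest of the cycle is a walk joining the ends of [e] that avoids [F e], so it is longer than
    [k] times the weight of [e]. *)
Lemma unblocked_cycle_weight C e c : is_cycle C c -> e \in cycle_edges c ->
  e \in X -> cycle_edges c :\ e \subset before e :\: F e ->
  (k + 1) * weight G e < wt G (cycle_edges c).
Proof.
move=> cc eC eX sC; have [_ _ [u [v [eE d]]]] := FP eX.
rewrite eE in eC.
have [p [pp lp wp]] := cycle_walk G cc eC; rewrite -eE in pp wp.
rewrite mulrDl mul1r -ltrBrDr -wp -lte_fin.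
apply: lt_le_trans d _; apply: ereal_inf_lbound; exists p => //; split=> //.
by apply: sub_path pp => a b; apply: (subsetP sC).
Qed.

Lemma unblocked_class_weight T J : T \subset Q -> J \subset X ->
  (forall x y, [set x; y] \in X -> connect (adj T) x y) ->
  (forall e, e \in J -> [disjoint F e & T]) ->
  (forall e x, e \in J -> x \in J -> x \notin F e) ->
  wt G J <= L * wt G T.
Proof.
move=> sTQ sJX conn FT FJ.
have sTG := subset_trans sTQ sQG; have sJG := subset_trans sJX added_sub.
have [|T' [sT' wT' br cT' cyc]] := @min_connector _ _ G T J sTG sJG.
  by move=> x y /(subsetP sJX); apply: conn.
pose K := T' :|: J.
have sKU : K \subset T :|: J by rewrite subUset sT' subsetUr.
have sKG : K \subset edges G by rewrite (subset_trans sKU) // subUset sTG.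
have sT'K : T' \subset K by apply: subsetUl.
apply: (@le_trans _ _ (wt G K)); first by apply: wt_sub => //; apply: subsetUr.
apply: (@le_trans _ _ (L * wt G T')); last by rewrite ler_wpM2l ?L_ge0.
apply: (lambda_lightness (sK := sKG) lamE); last first.
  split=> //; first by move=> c; apply: (bridges_acyclic G).
  exact/components_eqP.
apply: weighted_girth_gt => c cK; have [j jCJ jmax] := cyc c cK.
(* [e] is the edge of [J] on the cycle added last, so every other edge of the cycle was present when
   [e] was examined and none lies in [F e]. *)
case: (@arg_maxnP _ j [in cycle_edges c :&: J] (index^~ s) jCJ) => e.
rewrite [e \in _]inE => /andP[eC eJ] emax; have eX := subsetP sJX _ eJ.
have sC := cycle_edges_sub cK.
have lt : (k + 1) * weight G e < wt G (cycle_edges c).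
  apply: (unblocked_cycle_weight cK) => //.
  apply/subsetP => x; rewrite !inE => /andP[xe xC].
  have := subsetP sKU _ (subsetP sC _ xC); rewrite inE => /orP[xT|xJ].
    rewrite -/(before e) beforeE (subsetP sTQ _ xT) andbT.
    apply/negP => xF; have := FT e eJ; rewrite disjoint_subset.
    by move=> /subsetP/(_ x xF); rewrite inE xT.
  rewrite FJ //= -/(before e) beforeE (subsetP sJX _ xJ) ltn_neqAle /=.
  have -> : (index x s <= index e s)%N by apply: emax; rewrite inE xC.
  rewrite andbT; apply/orP; right; apply: contra xe => /eqP idx.
  have es := added_mem eX; have xs := added_mem (subsetP sJX _ xJ).
  by rewrite -[X in X == _](nth_index e xs) idx nth_index.
(* [j] is heaviest on the cycle, and [e] comes no earlier than [j] in the weight order. *)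
have emaxw g : g \in cycle_edges c -> weight G g <= weight G e.
  move=> gC; apply: le_trans (jmax g gC) _.
  have jJ : j \in J by move: jCJ; rewrite inE => /andP[].
  apply: (sorted_leq_index _ _ s_sorted).
  - by move=> a b d; apply: le_trans.
  - by move=> a; apply: lexx.
  - exact/added_mem/(subsetP sJX).
  - exact: added_mem.
  - exact: emax.
have e0 : 0 <= weight G e by apply/weight_ge0/(subsetP added_sub).
pose M := \big[Num.max/0]_(g in cycle_edges c) weight G g.
change (normalized_weight _ c) with ((wt G (cycle_edges c))%:E / M%:E)%E.
have M0 : 0 <= M by apply: bigmax_ge_id.
have Me : M <= weight G e by apply: bigmax_le.
have k0 : 0 <= k + 1 by rewrite addr_ge0 // (le_trans _ k1).
rewrite inver; case: (eqVneq M 0) => [_|MN].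
  rewrite gt0_muley ?ltry // lte_fin; apply: le_lt_trans lt.
  by rewrite mulr_ge0.
have Mp : 0 < M by rewrite lt_def MN.
rewrite -EFinM lte_fin ltr_pdivlMr //.
by apply: le_lt_trans lt; rewrite ler_wpM2l.
Qed.

Lemma unblocked_weight T : T \subset Q ->
  (forall x y, [set x; y] \in X -> connect (adj T) x y) ->
  wt G [set e in X | [disjoint F e & T]] <= (f.+1)%:R * (L * wt G T).
Proof.
move=> sTQ conn; set Y := [set e in X | _].
have sYX : Y \subset X by apply/subsetP => e; rewrite inE => /andP[].
(* Only faults among the added edges constrain the colours; faults in [Q] are handled by
   disjointness from [T]. *)
have [||col colP] := @degenerate_coloring _ f s
    (fun e => if e \in X then F e :&: X else set0) uniq_edges_left.
- move=> e _; case: ifP => [/FP[_ + _]|_]; last by rewrite cards0.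
  by apply: leq_trans; apply/subset_leq_card/subsetIl.
- move=> e x _ _; case: ifP => [eX|_]; last by rewrite inE.
  rewrite inE => /andP[xF xX]; have [/subsetP/(_ x xF) + _ _] := FP eX.
  rewrite -/(before e) beforeE; move: (xX); rewrite {1}inE => /andP[/negbTE -> _].
  by case/andP.
have colX e x : e \in X -> x \in X -> x \in F e -> col x != col e.
  move=> eX xX xF; apply: colP; rewrite ?added_mem //.
  by rewrite eX inE xF.
rewrite /wt (partition_big col predT) //= -/(wt G _).
apply: (@le_trans _ _ (\sum_(i < f.+1) L * wt G T)); last first.
  by rewrite sumr_const card_ord mulr_natl.
apply: ler_sum => i _.
rewrite (_ : \sum_(e in Y | col e == i) _ = wt G [set e in Y | col e == i]); last first.
  by apply: eq_bigl => e; rewrite [RHS]inE.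
have JY e : e \in [set e in Y | col e == i] -> e \in Y /\ col e = i.
  by rewrite [_ \in _]inE => /andP[-> /eqP ->].
apply: unblocked_class_weight => //.
- by apply/subsetP => e /JY[/(subsetP sYX)].
- by move=> e /JY[]; rewrite inE => /andP[].
- move=> e x /JY[eY ce] /JY[xY cx]; apply/negP => xF.
  by have := colX e x (subsetP sYX _ eY) (subsetP sYX _ xY) xF; rewrite ce cx eqxx.
Qed.

Lemma greedy_added_weight (eta : R) : 0 < eta -> (0 < f)%N ->
  eft_preserver G ((2 + eta) * f%:R) Q -> eta * wt G X <= 4 * (L * wt G Q).
Proof.
move=> eta0 f0 pQ; have f0R : 0 < f%:R :> R by rewrite ltr0n.
set N := (2 + eta) * f%:R in pQ.
have wX e : e \in X -> 0 <= weight G e.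
  by move=> eX; apply/weight_ge0/(subsetP added_sub).
(* Summed over [T], this cost is the upper bound for the weight of [X]: a term for the edges whose
   fault sets miss [T], and each weight counted once per fault in [T]. *)
pose c q := (f.+1)%:R * L * weight G q + \sum_(e in X | q \in F e) weight G e.
have cE A : \sum_(q in A) c q =
    (f.+1)%:R * L * wt G A + \sum_(e in X) weight G e * #|F e :&: A|%:R.
  rewrite big_split /= -mulr_sumr; congr (_ + _).
  rewrite (exchange_big_dep [in X]) /=; last by move=> q e _ /andP[].
  apply: eq_bigr => e eX; rewrite mulr_natr -sumr_const; apply: eq_bigl => q.
  by rewrite eX inE andbC.
have [||||T [sTQ /feasibleP conn cT]] :=
    @steiner_forest _ _ (fun u v => [set u; v] \in X) Q N _ _ _ c.
- by move=> e /(subsetP sQG); apply: edges_card2.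
- by rewrite mulr_gt0 // addr_gt0.
- move=> S /separatesP[u [v [uvX uvS]]]; apply/ltW/(eft_preserver_cut pQ _ _ uvS).
    exact: (subsetP added_sub).
  by move: uvX; rewrite inE => /andP[].
- move=> e eQ; apply: addr_ge0; last by apply: sumr_ge0 => g /andP[/wX].
  by rewrite !mulr_ge0 ?L_ge0 //; apply/weight_ge0/(subsetP sQG).
(* An edge whose fault set meets [T] is paid for by the second term, where its multiplicity is at
   least 1. *)
have XT : wt G X <= \sum_(q in T) c q.
  rewrite cE {1}/wt (big_setID [set e in X | [disjoint F e & T]]) /=.
  apply: lerD.
    rewrite setIC (setIidPl _); last by apply/subsetP => e; rewrite inE => /andP[].
    by rewrite -mulrA; apply: unblocked_weight.
  apply: (@le_trans _ _ (\sum_(e in X :\: [set e in X | [disjoint F e & T]])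
                           weight G e * #|F e :&: T|%:R)).
    apply: ler_sum => e; rewrite inE [in X in X -> _]inE negb_and => /andP[+ eX].
    rewrite eX /= => nd; rewrite ler_peMr ?wX // ler1n card_gt0.
    by rewrite setI_eq0.
  rewrite [X in _ <= X](big_setID [set e in X | [disjoint F e & T]]) /= lerDr.
  by apply: sumr_ge0 => e; rewrite inE => /andP[/wX w0 _]; rewrite mulr_ge0.
have Qc : \sum_(q in Q) c q <= (f.+1)%:R * L * wt G Q + f%:R * wt G X.
  rewrite cE lerD2l mulr_sumr; apply: ler_sum => e eX.
  rewrite mulrC ler_wpM2r ?wX // ler_nat.
  have [_ + _] := FP eX; apply: leq_trans.
  exact/subset_leq_card/subsetIl.
have LQ : 0 <= L * wt G Q by rewrite mulr_ge0 ?L_ge0 ?wt_ge0.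
have N0 : 0 <= N by rewrite mulr_ge0 // addr_ge0 // ltW.
have h1 : N * wt G X <= 2 * ((f.+1)%:R * L * wt G Q + f%:R * wt G X).
  apply: le_trans (ler_wpM2l N0 XT) (le_trans cT _).
  by rewrite ler_pM2l.
(* Since [f] is positive, [f + 1] is at most [2 * f]; with the factor 2 of the Steiner forest bound
   this yields the constant 4. *)
have h2 : (f.+1)%:R * (L * wt G Q) <= 2 * f%:R * (L * wt G Q).
  by rewrite ler_wpM2r // -natrM ler_nat mul2n -addnn -addn1 leq_add2l.
rewrite -(ler_pM2r f0R); move: h1 h2; rewrite /N -[_ * L * _]mulrA.
move: (L * wt G Q) (wt G X) (f.+1)%:R f%:R => a b F1 F0 h1 h2.
(* The faults inside [Q] cost [2 * f] times the weight of [X]; the slack [eta * f] in the cut size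
   is what remains after absorbing them. *)
have -> : eta * b * F0 = (2 + eta) * F0 * b - 2 * F0 * b by ring.
by rewrite lerBlDr; apply: le_trans h1 _; lra.
Qed.

End Blocking.

(** * The competitive lightness bound *)

(** A single edge of positive weight is a forest, of lightness 1. *)
Lemma lambda_ge1 (R : realType) (V : finType) (G : wgraph R V) (t L : R)
    (e : {set V}) : lambda #|V| t = L%:E -> e \in edges G -> 0 < weight G e -> 1 <= L.
Proof.
move=> lamE eG w0; have : wt G [set e] <= L * wt G [set e].
  apply: (acyclic_lightness lamE); first by rewrite sub1set.
  move=> x y; rewrite in_set1 => /eqP xyE; rewrite -xyE setDv setU0.
  apply/negP => xy; have [] := @connect_crossing _ set0 [set x] _ _ xy.
  - exact: set11.
  - have := edges_card2 eG; rewrite -xyE cards2 in_set1 [y == x]eq_sym.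
    by case: (x == y).
  - by move=> a [b []]; rewrite in_set0.
by rewrite /wt big_set1 -{1}[weight G e]mul1r ler_pM2r.
Qed.

(* C is absolute.  The factor is max(1, 1/eta) because the competitive lightness
   is at least 1 whenever the optimum is positive, so a bound C / eta * lambda
   cannot hold uniformly as eta grows; for eta <= 1 the factor is 1/eta. *)
Theorem theorem3p15 (R : realType) :
  exists C : R, 0 < C /\
    forall (eta : R), 0 < eta ->
    forall (n : nat) (V : finType) (G : wgraph R V), #|V| = n ->
    forall (k : R) (f : nat), 1 <= k -> (0 < f)%N ->
    forall H : {set {set V}},
      light_ft_greedy_output G k f ((2 + eta) * f%:R) H ->
      (competitive_lightness G ((2 + eta) * f%:R) H
         <= (C * Num.max 1 eta^-1)%:E * lambda n (k + 1))%E.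
Proof.
(* 4 for the added edges and 1 for [Q] itself. *)
exists 5; split; first by [].
move=> eta eta0 n V G nE k f k1 f0 H [Q [s [[pQ minQ] sE srt HE]]].
set N := (2 + eta) * f%:R in pQ minQ *; have sQG : Q \subset edges G by case: pQ.
set M := Num.max 1 eta^-1.
have M1 : 1 <= M by rewrite le_max lexx.
have MV : eta^-1 <= M by rewrite le_max lexx orbT.
have M0 : 0 < 5 * M by rewrite mulr_gt0 // (lt_le_trans _ M1).
have optE : ereal_inf [set x | exists2 Q, eft_preserver G N Q & x = (wt G Q)%:E]%classic
    = (wt G Q)%:E.
  apply/eqP; rewrite eq_le; apply/andP; split.
    by apply: ereal_inf_lbound; exists Q.
  by apply: le_ereal_inf_tmp => x [Q' pQ' ->]; rewrite lee_fin minQ.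
rewrite /competitive_lightness optE -nE.
have := lambda_ge0 G (k + 1); case lamE : (lambda _ _) => [L| |] // L0; last first.
  by rewrite gt0_muley ?lte_fin // leey.
rewrite lee_fin in L0.
have [F FP] := blocking_sets k f sE.
have hX := greedy_added_weight sQG sE srt FP lamE k1 eta0 f0 pQ.
set X := _ :\: Q in hX; have Q0 := wt_ge0 sQG.
have wH : wt G H = wt G Q + wt G X.
  rewrite HE {1}/wt (big_setID Q) /= setIC (setIidPl _) //.
  exact: greedy_run_sup.
(* Either [Q] has weight zero, or it contains an edge of positive weight and then [L] is at least
   1. *)
have QL : wt G Q <= L * wt G Q.
  case: (ltrgt0P (wt G Q)) => [Qp|Qn|->]; last by rewrite mulr0.
    have [e eQ e0] : exists2 e, e \in Q & 0 < weight G e.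
      apply/exists_inP; apply: contraTT Qp; rewrite negb_exists_in => /forall_inP h.
      by rewrite -leNgt; apply: sumr_le0 => e /h; rewrite -leNgt.
    rewrite ler_peMl // (lambda_ge1 lamE (subsetP sQG e eQ) e0) //.
  by rewrite leNgt Qn in Q0.
have LQ0 : 0 <= L * wt G Q by rewrite mulr_ge0.
have bound : wt G H <= 5 * M * L * wt G Q.
  have hX' : wt G X <= eta^-1 * (4 * (L * wt G Q)).
    by rewrite ler_pdivlMl.
  have h1 : eta^-1 * (4 * (L * wt G Q)) <= M * (4 * (L * wt G Q)).
    by rewrite ler_wpM2r // mulr_ge0.
  have h2 : 1 * (L * wt G Q) <= M * (L * wt G Q) by rewrite ler_wpM2r.
  rewrite wH -[5 * M * L * _]mulrA -[5 * M * _]mulrA; move: hX' h1 h2 QL.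
  rewrite mul1r [M * (4 * _)]mulrCA.
  move: (L * wt G Q) => a; move: (M * a) (eta^-1 * _) => b d; lra.
(* If the optimum is zero, the bound forces [H] to have weight zero, and the quotient 0 / 0 is 0. *)
rewrite inver -EFinM; case: (eqVneq (wt G Q) 0) => [QE|QN].
  rewrite QE mulr0 in bound; have H0 : wt G H = 0.
    apply/eqP; rewrite eq_le bound HE wt_ge0 //; apply/subsetP => e.
    move=> /greedy_run_sub/orP[/(subsetP sQG)//|].
    by rewrite (perm_mem sE) mem_enum inE => /andP[].
  by rewrite H0 mul0e lee_fin mulr_ge0 // ltW.
have Qp : 0 < wt G Q by rewrite lt_def QN.
by rewrite -EFinM lee_fin ler_pdivrMr.
Qed.
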